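(* Let $k$ be a field of characteristic zero, let $\overline{\mathbb{N}}=\mathbb{N}\cup\{-\infty\}$ be the monoid with operation $\max$, and let $H=k\overline{\mathbb{N}}$ be its monoid algebra. If $f\in H^\circ$, then $f$ is a linear combination of elements of $G(H^\circ)$.
   Context: The identity of $(\overline{\mathbb{N}},\max)$ is $-\infty$. $H^\circ=\{f\in \mathrm{Hom}_k(H,k)\mid f(I)=0\text{ for some ideal } I\subseteq H\text{ with }\dim(H/I)<\infty\}$ is the finite dual of $H$, a coalgebra with coproduct determined by $\Delta(f)(a\otimes b)=f(ab)$ and counit $\epsilon(f)=f(1)$. For a coalgebra $(C,\Delta,\epsilon)$, $G(C)=\{c\in C\mid\Delta(c)=c\otimes c,\ \epsilon(c)=1\}$ is the set of group-like elements. *)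

(* Defs.v *)
From HB Require Import structures.
From mathcomp Require Import all_boot all_algebra finmap.
From mathcomp Require Import boolp classical_sets functions.
From mathcomp.multinomials Require Import monalg.

Set Implicit Arguments.
Unset Strict Implicit.
Unset Printing Implicit Defensive.

Import GRing.Theory.
Local Open Scope ring_scope.

Section LinearProp.
Variables (k : fieldType) (V W : lmodType k) (f : V -> W).
Hypothesis lf : linear f.

Let F : {linear V -> W} := HB.pack f (GRing.isLinear.Build k V W _ f lf).

Lemma linear_f0 : f 0 = 0. Proof. exact: (linear0 F). Qed.
Lemma linear_fN x : f (- x) = - f x. Proof. exact: (linearN F). Qed.
Lemma linear_fB x y : f (x - y) = f x - f y. Proof. exact: (linearB F). Qed.
Lemma linear_fZ a x : f (a *: x) = a *: f x. Proof. exact: (linearZ_LR F). Qed.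
Lemma linear_fsum (I : Type) (r : seq I) (P : pred I) (E : I -> V) :
  f (\sum_(i <- r | P i) E i) = \sum_(i <- r | P i) f (E i).
Proof. exact: (linear_sum F). Qed.

End LinearProp.

Section Tensor.
Variables (k : fieldType) (V W : lmodType k).

(* The submodule of the free module on V * W by which the tensor product
   is a quotient. *)
Inductive tensor_rel : {malg k[(V * W)%type]} -> Prop :=
| tensor_rel0 : tensor_rel 0
| tensor_relD a x y : tensor_rel x -> tensor_rel y -> tensor_rel (a *: x + y)
| tensor_rel_l a v v' w :
    tensor_rel (<< (a *: v + v', w) >> - (a *: << (v, w) >> + << (v', w) >>))
| tensor_rel_r a v w w' :
    tensor_rel (<< (v, a *: w + w') >> - (a *: << (v, w) >> + << (v, w') >>)).

Definition tensor_ker : pred {malg k[(V * W)%type]} :=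
  fun x => `[< tensor_rel x >].

Lemma tensor_ker_zmod_closed : zmod_closed tensor_ker.
Proof.
split=> [|x y /asboolP hx /asboolP hy]; apply/asboolP; first exact: tensor_rel0.
by rewrite addrC -scaleN1r; apply: tensor_relD.
Qed.

HB.instance Definition _ :=
  GRing.isZmodClosed.Build _ tensor_ker tensor_ker_zmod_closed.

Definition tensor_kerc : zmodClosed {malg k[(V * W)%type]} :=
  GRing.ZmodClosed.clone _ tensor_ker _.

Definition tensor : Type := Quotient.quot tensor_kerc.

HB.instance Definition _ := GRing.Zmodule.on tensor.

Definition tensor_pi (x : {malg k[(V * W)%type]}) : tensor :=
  \pi_(Quotient.quot tensor_kerc)%qT x.

Definition tensor_repr (t : tensor) : {malg k[(V * W)%type]} :=
  repr (t : Quotient.quot tensor_kerc).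

Lemma tensor_reprK t : tensor_pi (tensor_repr t) = t.
Proof. exact: reprK. Qed.

Lemma tensor_piP x y : tensor_pi x = tensor_pi y <-> tensor_rel (x - y).
Proof.
rewrite /tensor_pi; split=> [/eqP|h].
  by rewrite -Quotient.idealrBE => /asboolP.
by apply/eqP; rewrite -Quotient.idealrBE; apply/asboolP.
Qed.

Lemma tensor_piD x y : tensor_pi (x + y) = tensor_pi x + tensor_pi y.
Proof. exact: Quotient.pi_add. Qed.

Definition tensor_scale (a : k) (t : tensor) : tensor :=
  tensor_pi (a *: tensor_repr t).

Lemma tensor_piZ a x : tensor_pi (a *: x) = tensor_scale a (tensor_pi x).
Proof.
apply/tensor_piP; rewrite -scalerBr -[_ *: _]addr0.
apply: tensor_relD; last exact: tensor_rel0.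
by apply/tensor_piP; rewrite tensor_reprK.
Qed.

Lemma tensor_scaleA a b t :
  tensor_scale a (tensor_scale b t) = tensor_scale (a * b) t.
Proof. by rewrite -[t]tensor_reprK -!tensor_piZ scalerA. Qed.

Lemma tensor_scale1 : left_id 1 tensor_scale.
Proof. by move=> t; rewrite -[t]tensor_reprK -!tensor_piZ scale1r. Qed.

Lemma tensor_scaleDr : right_distributive tensor_scale +%R.
Proof.
move=> a t u; rewrite -[t]tensor_reprK -[u]tensor_reprK.
by rewrite -tensor_piD -!tensor_piZ -tensor_piD scalerDr.
Qed.

Lemma tensor_scaleDl t : {morph tensor_scale^~ t : a b / a + b}.
Proof.
by move=> a b; rewrite -[t]tensor_reprK -!tensor_piZ -tensor_piD scalerDl.
Qed.

HB.instance Definition _ := GRing.Zmodule_isLmodule.Build k tensor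
  tensor_scaleA tensor_scale1 tensor_scaleDr tensor_scaleDl.

Definition tens (v : V) (w : W) : tensor := tensor_pi << (v, w) >>.

Lemma tensor_pi_linear : linear tensor_pi.
Proof. by move=> a x y; rewrite tensor_piD tensor_piZ. Qed.

HB.instance Definition _ :=
  GRing.isLinear.Build k _ tensor _ tensor_pi tensor_pi_linear.

Lemma tens_linearl w : linear (tens^~ w).
Proof.
by move=> a v v'; rewrite /tens -linearP; apply/tensor_piP/tensor_rel_l.
Qed.

Lemma tens_linearr v : linear (tens v).
Proof.
by move=> a w w'; rewrite /tens -linearP; apply/tensor_piP/tensor_rel_r.
Qed.

Lemma tensor_sum (t : tensor) :
  exists s : seq (V * W), t = \sum_(p <- s) tens p.1 p.2.
Proof.
rewrite -[t]tensor_reprK; set x := tensor_repr t.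
exists [seq (x@_p *: p.1, p.2) | p <- enum_fset (msupp x)]; rewrite big_map.
rewrite {1}[x]monalgE raddf_sum /=; apply: eq_bigr => p _.
have -> : << x@_p *g p >> = x@_p *: << p >> :> {malg k[(V * W)%type]}.
  by apply/malgP => q; rewrite mcoeffZ !mcoeffU mulrnAr mulr1.
rewrite linearZ /=; case: p => v w /=.
exact/esym/(linear_fZ (tens_linearl w)).
Qed.

Section Lift.
Variable U : lmodType k.

Definition bilinear_map (b : V -> W -> U) : Prop :=
  (forall w, linear (b^~ w)) /\ (forall v, linear (b v)).

Definition free_lift (b : V -> W -> U) (x : {malg k[(V * W)%type]}) : U :=
  \sum_(p <- msupp x) x@_p *: b p.1 p.2.

(* The linear map induced by b on the tensor product; it is only meaningful
   for bilinear b, see tens_liftE and tens_lift_linear. *)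
Definition tens_lift (b : V -> W -> U) (t : tensor) : U :=
  free_lift b (tensor_repr t).

Lemma free_liftw b x (d : {fset (V * W)}) : (msupp x `<=` d)%fset ->
  free_lift b x = \sum_(p <- d) x@_p *: b p.1 p.2.
Proof.
move=> le; rewrite /free_lift; apply: big_fset_incl => // p _.
by move=> /mcoeff_outdom ->; rewrite scale0r.
Qed.

Lemma free_lift_linear b : linear (free_lift b).
Proof.
move=> a x y; set d := (msupp x `|` msupp y `|` msupp (a *: x + y))%fset.
have dx : (msupp x `<=` d)%fset by rewrite /d -fsetUA fsubsetUl.
have dy : (msupp y `<=` d)%fset by rewrite /d fsetUAC fsubsetUr.
rewrite (@free_liftw b (a *: x + y) d) ?fsubsetUr //.
rewrite (free_liftw b dx) (free_liftw b dy) scaler_sumr -big_split /=.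
by apply: eq_bigr => p _; rewrite mcoeffD mcoeffZ scalerDl scalerA.
Qed.

HB.instance Definition _ b :=
  GRing.isLinear.Build k _ U _ (free_lift b) (free_lift_linear b).

Lemma free_liftU b v w : free_lift b << (v, w) >> = b v w.
Proof.
by rewrite (free_liftw b msuppU_le) big_seq_fset1 mcoeffUU scale1r.
Qed.

Lemma free_lift_rel b x : bilinear_map b -> tensor_rel x -> free_lift b x = 0.
Proof.
case=> bl br; elim=> [|a y z _ hy _ hz|a v v' w|a v w w'].
- exact: linear0.
- by rewrite free_lift_linear hy hz scaler0 addr0.
- by rewrite linearB /= free_lift_linear !free_liftU bl subrr.
- by rewrite linearB /= free_lift_linear !free_liftU br subrr.
Qed.

Lemma tens_lift_pi b x : bilinear_map b ->
  tens_lift b (tensor_pi x) = free_lift b x.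
Proof.
move=> hb; apply/eqP; rewrite -subr_eq0 -linearB; apply/eqP.
by apply: free_lift_rel => //; apply/tensor_piP; rewrite tensor_reprK.
Qed.

Lemma tens_liftE b v w : bilinear_map b -> tens_lift b (tens v w) = b v w.
Proof. by move=> hb; rewrite tens_lift_pi // free_liftU. Qed.

Lemma tens_lift_linear b : bilinear_map b -> linear (tens_lift b).
Proof.
move=> hb a t u; rewrite -[t]tensor_reprK -[u]tensor_reprK -linearP.
by rewrite !tens_lift_pi // linearP.
Qed.

Lemma tensor_ext (f g : tensor -> U) : linear f -> linear g ->
  (forall v w, f (tens v w) = g (tens v w)) -> f =1 g.
Proof.
move=> lf lg e t; have [s ->] := tensor_sum t.
rewrite (linear_fsum lf) (linear_fsum lg).
by apply: eq_bigr => p _; apply: e.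
Qed.

End Lift.
End Tensor.

Lemma tens_bilinear (k : fieldType) (V W : lmodType k) :
  bilinear_map (@tens k V W).
Proof. by split; [exact: tens_linearl|exact: tens_linearr]. Qed.

Section TensorMaps.
Variable k : fieldType.

Lemma linear_comp (U V W : lmodType k) (g : V -> W) (f : U -> V) :
  linear g -> linear f -> linear (g \o f).
Proof. by move=> lg lf a x y /=; rewrite lf lg. Qed.

Lemma linear_comb (V W : lmodType k) d (f g : V -> W) :
  linear f -> linear g -> linear (fun x => d *: f x + g x).
Proof.
move=> lf lg a x y; rewrite lf lg !scalerDr !scalerA addrACA.
by rewrite [d * a]mulrC.
Qed.

Lemma bilinear_comp (V W U U' : lmodType k) (h : U -> U') (b : V -> W -> U) :
  linear h -> bilinear_map b -> bilinear_map (fun v w => h (b v w)).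
Proof. by move=> lh [bl br]; split=> x a y z /=; rewrite ?bl ?br lh. Qed.

Lemma bilinear_precomp (V W V' W' U : lmodType k) (f : V -> V') (g : W -> W')
    (b : V' -> W' -> U) : linear f -> linear g -> bilinear_map b ->
  bilinear_map (fun v w => b (f v) (g w)).
Proof.
by move=> lf lg [bl br]; split=> x a y z /=; rewrite ?lf ?lg ?bl ?br.
Qed.

Lemma tens_lift_comp (V W U U' : lmodType k) (h : U -> U') (b : V -> W -> U) t :
  linear h -> bilinear_map b ->
  h (tens_lift b t) = tens_lift (fun v w => h (b v w)) t.
Proof.
move=> lh hb; have hb' := bilinear_comp lh hb; move: t.
apply: tensor_ext => [||v w].
- exact: linear_comp lh (tens_lift_linear hb).
- exact: tens_lift_linear.
- by rewrite !tens_liftE.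
Qed.

Definition tensor_map (V W V' W' : lmodType k) (f : V -> V') (g : W -> W') :
    tensor V W -> tensor V' W' :=
  tens_lift (fun v w => tens (f v) (g w)).

Definition tensor_assoc (U V W : lmodType k) :
    tensor U (tensor V W) -> tensor (tensor U V) W :=
  tens_lift (fun u => tens_lift (fun v w => tens (tens u v) w)).

Section Maps.
Variables (V W V' W' : lmodType k) (f : V -> V') (g : W -> W').
Hypotheses (lf : linear f) (lg : linear g).

Lemma tensor_map_linear : linear (tensor_map f g).
Proof. exact/tens_lift_linear/(bilinear_precomp lf lg)/tens_bilinear. Qed.

Lemma tensor_mapE v w : tensor_map f g (tens v w) = tens (f v) (g w).
Proof. exact/tens_liftE/(bilinear_precomp lf lg)/tens_bilinear. Qed.

End Maps.

Section Assoc.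
Variables U V W : lmodType k.

Definition tensor_assoc1 (u : U) : tensor V W -> tensor (tensor U V) W :=
  tens_lift (fun v w => tens (tens u v) w).

Lemma tensor_assoc1_bilinear u :
  bilinear_map (U := tensor (tensor U V) W) (fun v w => tens (tens u v) w).
Proof.
have lid : linear (@id W) by [].
exact: (bilinear_precomp (tens_linearr u) lid (tens_bilinear _ _)).
Qed.

Lemma tensor_assoc1_linear u : linear (tensor_assoc1 u).
Proof. exact/tens_lift_linear/tensor_assoc1_bilinear. Qed.

Lemma tensor_assoc1E u v w : tensor_assoc1 u (tens v w) = tens (tens u v) w.
Proof. exact/tens_liftE/tensor_assoc1_bilinear. Qed.

Lemma tensor_assoc_bilinear : bilinear_map tensor_assoc1.
Proof.
split=> [t d u u'|u]; last exact: tensor_assoc1_linear.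
pose h t := d *: tensor_assoc1 u t + tensor_assoc1 u' t.
apply: (@tensor_ext _ _ _ _ (tensor_assoc1 (d *: u + u')) h _ _ _ t).
- exact: tensor_assoc1_linear.
- exact: (linear_comb d (tensor_assoc1_linear u) (tensor_assoc1_linear u')).
- move=> v w; rewrite /h !tensor_assoc1E.
  by rewrite (tens_linearl v) (tens_linearl w).
Qed.

Lemma tensor_assoc_linear : linear (@tensor_assoc U V W).
Proof. exact/tens_lift_linear/tensor_assoc_bilinear. Qed.

Lemma tensor_assocE u t : tensor_assoc (tens u t) = tensor_assoc1 u t.
Proof. exact: (tens_liftE _ _ tensor_assoc_bilinear). Qed.

End Assoc.

End TensorMaps.

HB.mixin Record isCoalgebra (k : fieldType) C of GRing.Lmodule k C := {
  coproduct : C -> tensor C C;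
  counit : C -> k;
  coproduct_linear : linear coproduct;
  counit_linear : scalar counit;
  coassociative : forall c : C,
    tensor_assoc (tensor_map id coproduct (coproduct c)) =
    tensor_map coproduct id (coproduct c);
  counit_left : forall c : C,
    tens_lift (fun x y => counit x *: y) (coproduct c) = c;
  counit_right : forall c : C,
    tens_lift (fun x y => counit y *: x) (coproduct c) = c
}.

#[short(type="coalgType")]
HB.structure Definition Coalgebra (k : fieldType) :=
  {C of GRing.Lmodule k C & isCoalgebra k C}.

Definition grouplike (k : fieldType) (C : coalgType k) : set C :=
  [set c | coproduct c = tens c c /\ counit c = 1].
Arguments grouplike {k C}.

Section TensorSeparation.
Variables (k : fieldType) (V W : lmodType k) (A : Type) (e : A -> V -> k^o).
Hypothesis e_linear : forall a, linear (e a).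
Hypothesis e_sep : forall v, (forall a, e a v = 0) -> v = 0.

Lemma tensor_sep_seq n (s : seq (V * W)) : size s = n ->
  (forall a, \sum_(p <- s) e a p.1 *: p.2 = 0) ->
  \sum_(p <- s) tens p.1 p.2 = 0.
Proof.
elim: n s => [|n IH] [|[v w] s] //= => [_ _|[ss] h]; first by rewrite big_nil.
have [v0|/existsNP[a /eqP nz]] := pselect (forall a, e a v = 0).
  rewrite big_cons /= (e_sep v0).
  rewrite (linear_f0 (tens_linearl w)) add0r; apply: IH => // a.
  by have := h a; rewrite big_cons /= v0 scale0r add0r.
have wE : w = - \sum_(p <- s) (e a p.1 / e a v) *: p.2.
  have /eqP := h a; rewrite big_cons /= addr_eq0 => /eqP.
  move/(congr1 ( *:%R (e a v)^-1)); rewrite scalerA mulVf // scale1r => ->.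
  rewrite scalerN scaler_sumr; congr (- _); apply: eq_bigr => p _.
  by rewrite scalerA mulrC.
pose s' := [seq (p.1 - (e a p.1 / e a v) *: v, p.2) | p <- s].
have /IH : size s' = n by rewrite size_map.
rewrite big_map big_cons /= => IH0; rewrite -[RHS]IH0.
  have -> : tens v w = \sum_(p <- s) - ((e a p.1 / e a v : k) *: tens v p.2).
    rewrite {1}wE.
    rewrite (linear_fN (tens_linearr v)) (linear_fsum (tens_linearr v)) -sumrN.
    by apply: eq_bigr => p _; rewrite (linear_fZ (tens_linearr v)).
  rewrite -big_split; apply: eq_bigr => p _ /=.
  have tl := tens_linearl (V := V) p.2.
  by rewrite (linear_fB tl) (linear_fZ tl) addrC.
move=> b; rewrite big_map /=; rewrite -[RHS](h b) big_cons /= [in RHS]wE.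
rewrite scalerN scaler_sumr -sumrN -big_split; apply: eq_bigr => p _ /=.
rewrite (linear_fB (e_linear b)) (linear_fZ (e_linear b)) scalerBl addrC.
by rewrite scalerA; congr (_ + - (_ *: _)); apply: mulrC.
Qed.

Lemma tensor_sep_bilinear a : bilinear_map (fun v (w : W) => e a v *: w).
Proof.
split=> [w b x y|v b x y] /=; first by rewrite e_linear scalerDl scalerA.
by rewrite scalerDr !scalerA mulrC.
Qed.

Lemma tensor_sep (t : tensor V W) :
  (forall a, tens_lift (fun v w => e a v *: w) t = 0) -> t = 0.
Proof.
have [s ->] := tensor_sum t => h; apply: tensor_sep_seq (erefl _) _ => a.
rewrite -{}[RHS](h a).
rewrite (linear_fsum (tens_lift_linear (tensor_sep_bilinear a))).
apply: eq_bigr => p _ /=; by rewrite tens_liftE //; apply: tensor_sep_bilinear.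
Qed.

End TensorSeparation.

Section FiniteCodimension.
Variables (k : fieldType) (V : lmodType k).

Definition submodule (I : set V) : Prop :=
  I 0 /\ forall a x y, I x -> I y -> I (a *: x + y).

(* For a submodule I: V / I is spanned by finitely many classes. *)
Definition finite_codim (I : set V) : Prop :=
  exists (n : nat) (s : 'I_n -> V), forall x : V,
    exists c : 'I_n -> k, I (x - \sum_i c i *: s i).

Lemma finite_codim_coord (I : set V) : submodule I -> finite_codim I ->
  exists (n : nat) (s : 'I_n -> V) (c : 'I_n -> V -> k^o),
  [/\ forall i, linear (c i), forall x, I x -> forall i, c i x = 0,
      forall x, (forall i, c i x = 0) -> I x
    & forall x, I (x - \sum_i c i x *: s i)].
Proof.
move=> [I0 ID] fI.
have IZ a x : I x -> I (a *: x) by move=> Ix; rewrite -[_ *: _]addr0; apply: ID.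
have IA x y : I x -> I y -> I (x + y).
  by move=> Ix Iy; rewrite -[x]scale1r; apply: ID.
have IB x y : I x -> I y -> I (x - y).
  by move=> Ix Iy; apply: IA => //; rewrite -scaleN1r; apply: IZ.
pose P n := `[< exists s : 'I_n -> V, forall x,
    exists c : 'I_n -> k, I (x - \sum_i c i *: s i) >].
have exP : exists n, P n by have [n fIn] := fI; exists n; apply/asboolP.
case: (ex_minnP exP) => n /asboolP[s hs] nmin.
have free (d : 'I_n -> k) : I (\sum_i d i *: s i) -> forall j, d j = 0.
  move=> Id j; apply: contrapT => /eqP dj.
  case: n s hs nmin d Id j dj => [|n] s hs nmin d Id j dj; first by case: j dj.
  suff /nmin : P n by rewrite ltnn.
  apply/asboolP; exists (fun i => s (lift j i)) => x.
  have [c hc] := hs x.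
  exists (fun i => c (lift j i) - c j / d j * d (lift j i)).
  suff -> : \sum_i (c (lift j i) - c j / d j * d (lift j i)) *: s (lift j i) =
            \sum_i c i *: s i - (c j / d j) *: \sum_i d i *: s i.
    by rewrite opprB addrA addrAC; apply: IA; last exact: IZ.
  rewrite scaler_sumr -sumrB (bigD1_ord j) //= scalerA mulfVK // subrr add0r.
  by apply: eq_bigr => i _; rewrite scalerA scalerBl.
have [c hc] := choice hs.
exists n, s, (fun i x => c x i); split=> //.
- move=> i a x y; apply/eqP; rewrite -subr_eq0; apply/eqP.
  move: i; apply: (free (fun i => c (a *: x + y) i - (a *: (c x i : k^o) + c y i))).
  have := IB _ _ (ID a _ _ (hc x) (hc y)) (hc (a *: x + y)).
  under [X in _ -> I X]eq_bigr do rewrite scalerBl scalerDl -scalerA.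
  rewrite sumrB big_split /= -scaler_sumr scalerBr addrACA -opprD opprB.
  by rewrite [X in I X -> _]addrC addrA subrK.
- move=> x Ix; apply: free; have := IB _ _ Ix (hc x).
  by rewrite opprB addrC subrK.
- move=> x c0; have := hc x; rewrite big1 ?subr0 // => i _.
  by rewrite c0 scale0r.
Qed.

Lemma finite_codim_ker n (phi : V -> 'rV[k]_n) : linear phi ->
  finite_codim [set x | phi x = 0].
Proof.
move=> lphi.
pose P (r : nat) := `[< exists m (s : 'I_m -> V), \rank (\matrix_i phi (s i)) = r >].
have exP : exists r, P r.
  exists 0%N; apply/asboolP; exists 0%N, (fun _ => 0).
  by apply/eqP; rewrite -leqn0; apply: rank_leq_row.
have ubP r : P r -> (r <= n)%N.
  by move=> /asboolP[m [s <-]]; apply: rank_leq_col.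
case: (ex_maxnP exP ubP) => r /asboolP[m [s rk]] rmax.
exists m, s => x; set M := \matrix_i phi (s i) in rk.
suff /submxP[D hD] : (phi x <= M)%MS.
  exists (D 0); rewrite /= (linear_fB lphi) (linear_fsum lphi) hD.
  apply/eqP; rewrite subr_eq0 mulmx_sum_row; apply/eqP.
  by apply: eq_bigr => i _; rewrite rowK (linear_fZ lphi).
pose s' (i : 'I_(m + 1)) := match fintype.split i with inl j => s j | inr _ => x end.
have sE : \matrix_i phi (s' i) = col_mx M (phi x).
  apply/row_matrixP => i; rewrite rowK /s'.
  case: (split_ordP i) => j ->; first by rewrite rowKu rowK.
  by rewrite rowKd ord1 row_id.
have MM : (M <= col_mx M (phi x))%MS by rewrite -addsmxE addsmxSl.
have /rmax le : P (\rank (col_mx M (phi x))).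
  by apply/asboolP; exists (m + 1)%N, s'; rewrite sE.
apply: (@submx_trans _ _ _ _ _ _ (col_mx M (phi x))).
  by rewrite -addsmxE addsmxSr.
by rewrite -(geq_leqif (mxrank_leqif_sup MM)) rk.
Qed.

End FiniteCodimension.

Section FiniteDual.
Variables (k : fieldType) (H : algType k).

Definition two_sided_ideal (I : set H) : Prop :=
  [/\ I 0, forall x y, I x -> I y -> I (x + y)
    & forall a x, I x -> I (a * x) /\ I (x * a)].

Definition in_finite_dual (f : H -> k^o) : Prop :=
  linear f /\ exists I : set H,
    [/\ two_sided_ideal I, finite_codim I & forall x, I x -> f x = 0].

Definition finite_dual_pred : pred (H -> k^o) := fun f => `[< in_finite_dual f >].

Lemma two_sided_ideal_submodule I : two_sided_ideal I -> submodule I.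
Proof.
case=> I0 ID IM; split=> // a x y Ix Iy; apply: ID => //.
by rewrite -[x]mul1r scalerAl; apply: (IM _ _ Ix).1.
Qed.

Lemma finite_codimI (I J : set H) : submodule I -> submodule J ->
  finite_codim I -> finite_codim J -> finite_codim (I `&` J)%classic.
Proof.
move=> sI sJ /(finite_codim_coord sI)[n [_ [c [lc cI Ic _]]]].
move=> /(finite_codim_coord sJ)[m [_ [d [ld dJ Jd _]]]].
pose phi x : 'rV[k]_(n + m) := row_mx (\row_i c i x) (\row_i d i x).
have lphi : linear phi.
  move=> a x y; rewrite /phi scale_row_mx add_row_mx.
  by congr row_mx; apply/rowP => i; rewrite !mxE ?lc ?ld.
have [p [s hs]] := finite_codim_ker lphi.
exists p, s => x; have [e he] := hs x; exists e.
move: he; rewrite /= /phi -row_mx0 => /eq_row_mx[/rowP e1 /rowP e2].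
by split; [apply: Ic => i; have := e1 i|apply: Jd => i; have := e2 i];
  rewrite !mxE.
Qed.

Lemma finite_dual_submod_closed : submod_closed finite_dual_pred.
Proof.
split=> [|a f g /asboolP[lf [I [iI cI fI]]] /asboolP[lg [J [iJ cJ gJ]]]];
  apply/asboolP.
  split=> [b x y|]; first by rewrite /= scaler0 addr0.
  exists setT; split=> //; exists 0%N, (fun=> 0) => x.
  by exists (fun=> 0).
split=> [b x y|].
  rewrite !fctE lf lg !scalerDr !scalerA addrACA; congr (_ + _ + (_ + _)).
  by rewrite mulrC.
exists (I `&` J)%classic; split.
- case: iI iJ => I0 ID IM [J0 JD JM].
  split=> // [x y [Ix Jx] [Iy Jy]|b x [Ix Jx]].
    by split; [apply: ID|apply: JD].
  by have [? ?] := IM b x Ix; have [? ?] := JM b x Jx; split; split.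
- by apply: finite_codimI => //; apply: two_sided_ideal_submodule.
- by move=> x [Ix Jx]; rewrite !fctE fI // gJ // scaler0 addr0.
Qed.

HB.instance Definition _ := GRing.isSubmodClosed.Build k _ finite_dual_pred
  finite_dual_submod_closed.

Record finite_dual : Type := FiniteDual {
  finite_dual_val :> H -> k^o;
  finite_dual_valP : finite_dual_val \in finite_dual_pred }.

HB.instance Definition _ := [isSub for finite_dual_val].
HB.instance Definition _ := [Choice of finite_dual by <:].
HB.instance Definition _ := [SubChoice_isSubLmodule of finite_dual by <:].

Lemma finite_dualP (f : finite_dual) : in_finite_dual f.
Proof. exact/asboolP/(finite_dual_valP f). Qed.

Lemma finite_dual_linear (f : finite_dual) : linear f.
Proof. by have [] := finite_dualP f. Qed.

Lemma finite_dual_ext (f g : finite_dual) : f =1 g -> f = g.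
Proof. by move=> e; apply/val_inj/funext. Qed.

Lemma finite_dual_ev_linear (x : H) : linear (fun f : finite_dual => f x).
Proof. by []. Qed.

Lemma finite_dual_ev_sep (f : finite_dual) : (forall x, f x = 0) -> f = 0.
Proof. by move=> f0; apply: finite_dual_ext => x; rewrite f0. Qed.

(* The value on a (x) b of an element of the tensor square, which is viewed
   as a linear form on the tensor square of H. *)
Definition finite_dual_pair (t : tensor finite_dual finite_dual) (a b : H) : k^o :=
  tens_lift (fun f g : finite_dual => f a * g b : k^o) t.

Lemma finite_dual_pair_bilinear a b :
  bilinear_map (fun f g : finite_dual => f a * g b : k^o).
Proof.
split=> [g c f f'|f c g g'].
  by apply: (etrans (mulrDl (c * f a) (f' a) (g b))); rewrite -mulrA.
by apply: (etrans (mulrDr (f a) (c * g b) (g' b))); rewrite mulrCA.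
Qed.

Lemma finite_dual_pair_linear a b : linear (fun t => finite_dual_pair t a b).
Proof. exact: tens_lift_linear (finite_dual_pair_bilinear a b). Qed.

Lemma finite_dual_pairE f g a b : finite_dual_pair (tens f g) a b = f a * g b.
Proof. exact: tens_liftE (finite_dual_pair_bilinear a b). Qed.

Lemma finite_dual_pair_sep t : (forall a b, finite_dual_pair t a b = 0) -> t = 0.
Proof.
move=> t0; apply: (@tensor_sep _ _ _ _ (fun x (f : finite_dual) => f x)).
- exact: finite_dual_ev_linear.
- exact: finite_dual_ev_sep.
move=> a; apply: finite_dual_ext => b; rewrite -[RHS](t0 a b).
apply: (tens_lift_comp (h := fun f : finite_dual => f b)) => //.
exact: (tensor_sep_bilinear _ finite_dual_ev_linear).
Qed.

Lemma finite_dual_pair_inj t u :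
  (forall a b, finite_dual_pair t a b = finite_dual_pair u a b) -> t = u.
Proof.
move=> e; apply/eqP; rewrite -subr_eq0; apply/eqP/finite_dual_pair_sep => a b.
by rewrite (linear_fB (finite_dual_pair_linear a b)) e subrr.
Qed.

Lemma finite_dual_coproduct_ex (f : finite_dual) :
  exists t, forall a b, finite_dual_pair t a b = f (a * b).
Proof.
have [lf [I [iI cI fI]]] := finite_dualP f.
have sI := two_sided_ideal_submodule iI.
have [I0 ID IM] := iI.
have [n [s [c [lc Ic _ hs]]]] := finite_codim_coord sI cI.
have hc i : c i \in finite_dual_pred.
  by apply/asboolP; split=> //; exists I; split=> // x /Ic.
have hg i : (fun b => f (s i * b)) \in finite_dual_pred.
  apply/asboolP; split=> [a x y|]; first by rewrite mulrDr -scalerAr lf.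
  by exists I; split=> // x Ix; apply: fI; apply: (IM _ _ Ix).1.
exists (\sum_i tens (FiniteDual (hc i)) (FiniteDual (hg i))) => a b.
rewrite (linear_fsum (finite_dual_pair_linear a b)).
under eq_bigr do rewrite finite_dual_pairE /=.
have fB := linear_fB lf; have := fI _ (IM b _ (hs a)).2.
rewrite mulrBl fB => /eqP; rewrite subr_eq0 => /eqP ->.
rewrite mulr_suml (linear_fsum lf); apply: eq_bigr => i _.
by rewrite -scalerAl (linear_fZ lf).
Qed.

(* The element whose value on a (x) b is f (a * b); it is unique by
   finite_dual_pair_inj. *)
Definition finite_dual_coproduct (f : finite_dual) :
  tensor finite_dual finite_dual := projT1 (cid (finite_dual_coproduct_ex f)).

Definition finite_dual_counit (f : finite_dual) : k := f 1.

Lemma finite_dual_coproductE f a b :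
  finite_dual_pair (finite_dual_coproduct f) a b = f (a * b).
Proof. by rewrite /finite_dual_coproduct; case: cid. Qed.

Lemma finite_dual_coproduct_linear : linear finite_dual_coproduct.
Proof.
move=> c f g; apply: finite_dual_pair_inj => a b.
by rewrite finite_dual_pair_linear !finite_dual_coproductE.
Qed.

Lemma finite_dual_counit_linear : scalar finite_dual_counit.
Proof. by []. Qed.

Lemma finite_dual_counitl f :
  tens_lift (fun x y => finite_dual_counit x *: y) (finite_dual_coproduct f) = f.
Proof.
apply: finite_dual_ext => b; rewrite -[b in RHS]mul1r -finite_dual_coproductE.
apply: (tens_lift_comp (h := fun f : finite_dual => f b)) => //.
exact: (tensor_sep_bilinear _ finite_dual_ev_linear).
Qed.

Lemma finite_dual_counitr f :
  tens_lift (fun x y => finite_dual_counit y *: x) (finite_dual_coproduct f) = f.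
Proof.
apply: finite_dual_ext => a; rewrite -[a in RHS]mulr1 -finite_dual_coproductE.
rewrite (tens_lift_comp (h := fun f : finite_dual => f a)) //.
  congr tens_lift; apply/funext => x; apply/funext => y.
  exact: (mulrC (y 1) (x a)).
have [bl br] := tensor_sep_bilinear finite_dual finite_dual_ev_linear 1.
by split=> [w|v]; [exact: br|exact: bl].
Qed.

Definition finite_dual_triple
    (t : tensor (tensor finite_dual finite_dual) finite_dual) (a b c : H) : k^o :=
  tens_lift (fun u (h : finite_dual) => finite_dual_pair u a b * h c : k^o) t.

Lemma finite_dual_triple_bilinear a b c : bilinear_map
  (fun u (h : finite_dual) => finite_dual_pair u a b * h c : k^o).
Proof.
split=> [g d f f'|f d g g'] /=.
  by rewrite finite_dual_pair_linear mulrDl -mulrA.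
apply: (etrans (mulrDr (finite_dual_pair f a b) (d * g c) (g' c))).
by rewrite mulrCA.
Qed.

Lemma finite_dual_triple_linear a b c :
  linear (fun t => finite_dual_triple t a b c).
Proof. exact: tens_lift_linear (finite_dual_triple_bilinear a b c). Qed.

Lemma finite_dual_tripleE u h a b c :
  finite_dual_triple (tens u h) a b c = finite_dual_pair u a b * h c.
Proof. exact: tens_liftE (finite_dual_triple_bilinear a b c). Qed.

Lemma finite_dual_triple_inj t u :
  (forall a b c, finite_dual_triple t a b c = finite_dual_triple u a b c) ->
  t = u.
Proof.
move=> e; apply/eqP; rewrite -subr_eq0; apply/eqP.
apply: (@tensor_sep _ _ _ _ (fun p t => finite_dual_pair t p.1 p.2)).
- by move=> p; apply: finite_dual_pair_linear.
- by move=> v v0; apply: finite_dual_pair_sep => a b; apply: (v0 (a, b)).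
move=> [a b]; apply: finite_dual_ext => c /=.
transitivity (finite_dual_triple (t - u) a b c); last first.
  by rewrite (linear_fB (finite_dual_triple_linear a b c)) e subrr.
apply: (tens_lift_comp (h := fun f : finite_dual => f c)) => //.
by apply: (tensor_sep_bilinear
  (e := fun (p : H * H) t => finite_dual_pair t p.1 p.2) _ _ (a, b)) => p;
  apply: finite_dual_pair_linear.
Qed.

Lemma finite_dual_coassociative f :
  tensor_assoc (tensor_map id finite_dual_coproduct (finite_dual_coproduct f)) =
  tensor_map finite_dual_coproduct id (finite_dual_coproduct f).
Proof.
have lid : linear (@id finite_dual) by [].
have lD := finite_dual_coproduct_linear.
have lT a b c := finite_dual_triple_linear a b c.
apply: finite_dual_triple_inj => a b c.
have e1 t : finite_dual_triple
      (tensor_assoc (tensor_map id finite_dual_coproduct t)) a b c =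
    finite_dual_pair t a (b * c).
  apply: (tensor_ext (f := fun t => finite_dual_triple
      (tensor_assoc (tensor_map id finite_dual_coproduct t)) a b c)
    (g := fun t => finite_dual_pair t a (b * c))) => {t} [||g h].
  - apply: (linear_comp (lT a b c)).
    by apply: linear_comp (@tensor_assoc_linear _ _ _ _) _; apply: tensor_map_linear.
  - exact: finite_dual_pair_linear.
  rewrite (tensor_mapE lid lD) tensor_assocE finite_dual_pairE.
  rewrite -finite_dual_coproductE; move: (finite_dual_coproduct h) => t.
  apply: (tensor_ext (f := fun t => finite_dual_triple (tensor_assoc1 g t) a b c)
    (g := fun t => g a * finite_dual_pair t b c : k^o)) => {t} [||v w].
  - exact: (linear_comp (lT a b c) (@tensor_assoc1_linear _ _ _ _ g)).
  - move=> d x y; rewrite finite_dual_pair_linear mulrDr.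
    by congr (_ + _); apply: mulrCA.
  - rewrite tensor_assoc1E finite_dual_tripleE.
    apply: (etrans (congr1 (fun z => z * w c) (finite_dual_pairE g v a b))).
    apply: (etrans (esym (mulrA (g a) (v b) (w c)))).
    exact: (congr1 (fun z => g a * z) (esym (finite_dual_pairE v w b c))).
have e2 t : finite_dual_triple (tensor_map finite_dual_coproduct id t) a b c =
    finite_dual_pair t (a * b) c.
  apply: (tensor_ext (f := fun t => finite_dual_triple
      (tensor_map finite_dual_coproduct id t) a b c)
    (g := fun t => finite_dual_pair t (a * b) c)) => {t} [||g h].
  - by apply: (linear_comp (lT a b c)); apply: tensor_map_linear.
  - exact: finite_dual_pair_linear.
  rewrite (tensor_mapE lD lid) finite_dual_tripleE.
  by rewrite finite_dual_coproductE finite_dual_pairE.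
by rewrite e1 e2 !finite_dual_coproductE mulrA.
Qed.

HB.instance Definition _ := isCoalgebra.Build k finite_dual
  finite_dual_coproduct_linear finite_dual_counit_linear
  finite_dual_coassociative finite_dual_counitl finite_dual_counitr.

End FiniteDual.

(* The monoid of natural numbers with -oo adjoined, under maximum;
   None stands for -oo. *)
Definition Nbar : Type := option nat.

HB.instance Definition _ := Choice.on Nbar.

Definition nbar_max (x y : Nbar) : Nbar :=
  match x, y with
  | None, _ => y
  | _, None => x
  | Some m, Some n => Some (maxn m n)
  end.

Lemma nbar_maxA : associative nbar_max.
Proof. by case=> [x|] [y|] [z|] //=; rewrite maxnA. Qed.

Lemma nbar_max0 : left_id None nbar_max. Proof. by case. Qed.

Lemma nbar_maxC : commutative nbar_max.
Proof. by case=> [x|] [y|] //=; rewrite maxnC. Qed.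

Lemma nbar_max0r : right_id None nbar_max. Proof. by case. Qed.

Lemma nbar_max_unit x y : nbar_max x y = None -> x = None /\ y = None.
Proof. by case: x y => [x|] [y|]. Qed.

HB.instance Definition _ := Choice_isMonomialDef.Build Nbar
  nbar_maxA nbar_max0 nbar_max0r nbar_max_unit.
HB.instance Definition _ := MonomialDef_isConomialDef.Build Nbar nbar_maxC.

(* Main.v *)
Require Import Defs.
From HB Require Import structures.
From mathcomp Require Import all_boot all_algebra.
From mathcomp Require Import boolp classical_sets.
From mathcomp.multinomials Require Import monalg.
Import GRing.Theory.
Local Open Scope ring_scope.

(** Shifting by one identifies the monoid with (nat, maxn), the identity -oo
    becoming 0; let z_0 = 1, z_1, z_2, ... be the resulting basis of H, so that
    z_m * z_n = z_(max m n). The differences e_j = z_j - z_(j+1) satisfy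
    z_n * e_j = e_j if n <= j and z_n * e_j = 0 if n > j: they are orthogonal
    idempotents.

    Let f vanish on an ideal I of finite codimension. From some index N on, each
    e_j is congruent modulo I to a combination of e_0, ..., e_(N-1)
    ([finite_codim_seq_span]). Multiplying this congruence by z_j kills every
    e_i with i < j and fixes e_j, hence e_j lies in I and f (e_j) = 0: the
    sequence f (z_n) is constant for n >= N ([finite_dual_stationary]).

    On the other hand, algebra morphisms H -> k are group-like elements of the
    finite dual ([character_grouplike]). Those of H are the indicators psi_t of
    the initial segments of the monoid, psi_t (z_n) = [n <= t], together with
    the augmentation psi_oo, which is 1 on every z_n. Summation by parts turns
    stationarity into the finite expansion
      f = f (e_0) psi_0 + ... + f (e_(N-1)) psi_(N-1) + f (z_N) psi_oo
    ([finite_dual_threshold]). *)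

(** The ranks of the spans of the first m classes in the quotient by [I] are
    nondecreasing in m and bounded by its dimension; any [N] at which the
    maximum is reached works. *)
Lemma finite_codim_seq_span {k : fieldType} {V : lmodType k} {I : set V} :
  submodule I -> finite_codim I -> forall v : nat -> V,
  exists N, forall j, (N <= j)%N ->
    exists c : 'I_N -> k, I (v j - \sum_i c i *: v i).
Proof.
move=> sI /(finite_codim_coord sI)[n [_ [c [c_lin _ cI _]]]] v.
pose phi x : 'rV[k]_n := \row_i c i x.
have phi_lin : linear phi by move=> a x y; apply/rowP => i; rewrite !mxE c_lin.
pose M m := \matrix_(i < m) phi (v i).
have subM i m : (i < m)%N -> (phi (v i) <= M m)%MS.
  move=> lt_im.
  by rewrite -[phi _](rowK (fun j : 'I_m => phi (v j)) (Ordinal lt_im)) row_sub.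
pose P r := `[< exists m, \rank (M m) = r >].
have exP : exists r, P r.
  by exists (\rank (M 0%N)); apply/asboolP; exists 0%N.
have ubP r : P r -> (r <= n)%N by move=> /asboolP[m <-]; apply: rank_leq_col.
case: (ex_maxnP exP ubP) => r /asboolP[N rkN] rmax.
exists N => j leNj.
have sMM : (M N <= M j.+1)%MS.
  by apply/row_subP => i; rewrite rowK subM // (leq_trans (ltn_ord i)) // ltnW.
have rkj : (\rank (M j.+1) <= r)%N by apply: rmax; apply/asboolP; exists j.+1.
have : (phi (v j) <= M N)%MS.
  apply: submx_trans (subM j j.+1 (ltnSn j)) _.
  by rewrite -(geq_leqif (mxrank_leqif_sup sMM)) rkN.
case/submxP => D phi_vj; exists (D 0) => //; apply: cI => i.
suff /rowP/(_ i) : phi (v j - \sum_(l < N) D 0 l *: v l) = 0 by rewrite !mxE.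
rewrite (linear_fB phi_lin) (linear_fsum phi_lin) phi_vj mulmx_sum_row.
apply/eqP; rewrite subr_eq0; apply/eqP/eq_bigr => l _.
by rewrite rowK (linear_fZ phi_lin).
Qed.

Section Characters.
Variables (k : fieldType) (H : algType k) (chi : H -> k^o).
Hypotheses (chi_lin : linear chi) (chi1 : chi 1 = 1).
Hypothesis chiM : forall x y, chi (x * y) = (chi x : k) * chi y.

(** The kernel is an ideal, of codimension one since [x - chi x *: 1] lies
    in it. *)
Lemma character_finite_dual : chi \in @finite_dual_pred k H.
Proof.
apply/asboolP; split=> //; exists [set x | chi x = 0]%classic; split=> //.
- split=> [|x y /= x0 y0|a x /= x0]; first exact: (linear_f0 chi_lin).
  + by rewrite -[x]scale1r chi_lin x0 y0 scaler0 addr0.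
  + by rewrite !chiM x0 mulr0 mul0r.
- exists 1%N, (fun=> 1) => x; exists (fun=> chi x) => /=.
  rewrite big_ord1 (linear_fB chi_lin) (linear_fZ chi_lin) chi1.
  by rewrite [_ *: _]mulr1 subrr.
Qed.

Definition character : finite_dual H := FiniteDual character_finite_dual.

(** Elements of the tensor square are determined by their values on pairs, and
    there the coproduct of [chi] is [chi (a * b)]. *)
Lemma character_grouplike : grouplike character.
Proof.
split=> //; apply: finite_dual_pair_inj => a b.
by rewrite [LHS]finite_dual_coproductE finite_dual_pairE /= chiM.
Qed.

End Characters.

(** [nbar_rank] and [nbar_nth] are mutually inverse isomorphisms between the
    monoid and (nat, maxn). Working in nat gives -oo no special role. *)
Definition nbar_rank (x : Nbar) : nat := if x is Some m then m.+1 else 0%N.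
Definition nbar_nth (n : nat) : Nbar := if n is m.+1 then Some m else None.

Lemma nbar_rankK : cancel nbar_rank nbar_nth. Proof. by case. Qed.
Lemma nbar_nthK : cancel nbar_nth nbar_rank. Proof. by case. Qed.

Lemma nbar_rank_max (x y : Nbar) :
  nbar_rank (mmul x y) = maxn (nbar_rank x) (nbar_rank y).
Proof. by case: x y => [m|] [n|] //=; rewrite ?maxnSS ?maxn0 ?max0n. Qed.

(** Summation by parts for a sequence that is constant from [N] on: the sum
    telescopes to [u n - u N] when [n < N], and is empty otherwise. *)
Lemma stationary_summation {R : pzRingType} (u : nat -> R) N n :
  (forall m, (N <= m)%N -> u m = u N) ->
  u n = \sum_(t < N) (u t - u t.+1) * (n <= t)%:R + u N.
Proof.
move=> uN; case: (leqP N n) => [leNn|ltnN].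
  rewrite uN // big1 ?add0r // => t _.
  by rewrite leqNgt (leq_trans (ltn_ord t) leNn) mulr0.
rewrite -(big_mkord xpredT (fun t => (u t - u t.+1) * (n <= t)%:R)).
rewrite (big_cat_nat (leq0n n) (ltnW ltnN)) /= big_nat big1 ?add0r; last first.
  by move=> t /andP[_ ltn]; rewrite leqNgt ltn mulr0.
rewrite big_nat; under eq_bigr => t /andP[-> _] do rewrite mulr1 -opprB.
by rewrite -big_nat sumrN telescope_sumr ?(ltnW ltnN) // opprB subrK.
Qed.

Section MaxAlgebra.
Variable k : fieldType.
Local Notation H := {malg k[Nbar]}.

Definition chain (n : nat) : H := << nbar_nth n >>.

Lemma chainM m n : chain m * chain n = chain (maxn m n).
Proof.
rewrite [LHS]fgmulUU mulr1 /chain; congr << _ >>.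
by apply: (can_inj nbar_rankK); rewrite nbar_rank_max !nbar_nthK.
Qed.

Lemma linear_chain_ext (f g : H -> k^o) : linear f -> linear g ->
  (forall n, f (chain n) = g (chain n)) -> f =1 g.
Proof.
move=> f_lin g_lin fg x; rewrite [x]monalgE.
rewrite (linear_fsum f_lin) (linear_fsum g_lin); apply: eq_bigr => m _.
have -> : << x@_m *g m >> = x@_m *: chain (nbar_rank m).
  rewrite /chain nbar_rankK.
  by apply/malgP => q; rewrite mcoeffZ !mcoeffU mulrnAr mulr1.
by rewrite (linear_fZ f_lin) (linear_fZ g_lin) fg.
Qed.

Definition step (j : nat) : H := chain j - chain j.+1.

Lemma chain_step_gt i j : (i < j)%N -> chain j * step i = 0.
Proof.
move=> lt_ij.
by rewrite mulrBr !chainM (maxn_idPl lt_ij) (maxn_idPl (ltnW lt_ij)) subrr.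
Qed.

Lemma chain_step j : chain j * step j = step j.
Proof. by rewrite mulrBr !chainM maxnn (maxn_idPr (leqnSn j)). Qed.

(** An ideal that contains [step n - \sum_(i < N) c i *: step i], where
    [N <= n], contains its product with [chain n], which is [step n]. *)
Lemma finite_dual_stationary (f : finite_dual H) :
  exists N, forall n, (N <= n)%N -> f (chain n) = f (chain N).
Proof.
have [f_lin [I [iI cI fI]]] := finite_dualP f.
have [_ _ IM] := iI.
have [N spanN] := finite_codim_seq_span (two_sided_ideal_submodule iI) cI step.
exists N; elim=> [|n IH]; first by rewrite leqn0 => /eqP->.
rewrite leq_eqVlt => /predU1P[<- //|leNn]; rewrite -(IH leNn).
have [c Ic] := spanN n leNn.
have /fI := (IM (chain n) _ Ic).1.
rewrite mulrBr chain_step mulr_sumr big1 => [|i _]; last first.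
  by rewrite -scalerAr chain_step_gt ?scaler0 // (leq_trans (ltn_ord i)).
by rewrite subr0 (linear_fB f_lin) => /eqP; rewrite subr_eq0 => /eqP.
Qed.

(** [None] is the infinite threshold, which gives the augmentation. *)
Definition below (t : option nat) (n : nat) : bool :=
  if t is Some m then (n <= m)%N else true.

Definition threshold_value (t : option nat) (x : Nbar) : k :=
  (below t (nbar_rank x))%:R.

(** A maximum is at most [t] exactly when both arguments are, and the least
    element 0 always is. *)
Lemma threshold_value_mmorphism t : mmorphism (threshold_value t).
Proof.
split=> [x y|]; rewrite /threshold_value; last by case: t.
rewrite nbar_rank_max; case: t => [t|] /=; rewrite ?mulr1 // geq_max.
by rewrite -natrM mulnb.
Qed.

HB.instance Definition _ t := isMultiplicative.Build Nbar k
  (threshold_value t) (threshold_value_mmorphism t).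

Definition threshold_map t : H -> k^o := mmap idfun (threshold_value t).

Lemma threshold_map_linear t : linear (threshold_map t).
Proof. exact: linearP. Qed.

Lemma threshold_map1 t : threshold_map t 1 = 1.
Proof. exact: rmorph1. Qed.

Lemma threshold_mapM t x y :
  threshold_map t (x * y) = (threshold_map t x : k) * threshold_map t y.
Proof. exact: rmorphM. Qed.

Lemma threshold_map_chain t n : threshold_map t (chain n) = (below t n)%:R.
Proof. by rewrite /threshold_map mmapU mul1r /threshold_value nbar_nthK. Qed.

Definition threshold t : finite_dual H :=
  character _ _ _ (threshold_map_linear t) (threshold_map1 t) (threshold_mapM t).

Lemma threshold_grouplike t : grouplike (threshold t).
Proof. exact: character_grouplike. Qed.

(** Evaluated at [chain n], this is the summation by parts of the sequence
    [f (chain n)]. *)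
Lemma finite_dual_threshold (f : finite_dual H) N :
  (forall n, (N <= n)%N -> f (chain n) = f (chain N)) ->
  f = \sum_(t < N) (f (step t) : k) *: threshold (Some (t : nat))
      + (f (chain N) : k) *: threshold None.
Proof.
move=> fN; have f_lin := finite_dual_linear f; apply: finite_dual_ext.
apply: linear_chain_ext => [//||n]; first exact: finite_dual_linear.
rewrite [LHS](stationary_summation (fun n => f (chain n) : k) N n fN).
have ev_lin := finite_dual_ev_linear (chain n).
rewrite addrC [in RHS]addrC ev_lin (linear_fsum ev_lin) /= threshold_map_chain.
congr (_ + _); first by rewrite [RHS]mulr1.
apply: eq_bigr => t _.
by rewrite -(threshold_map_chain (Some (t : nat))) -(linear_fB f_lin).
Qed.

End MaxAlgebra.

Theorem theorem4p6 (k : fieldType) (k_char0 : [pchar k] =i pred0)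
    (f : finite_dual {malg k[Nbar]}) :
  exists (n : nat) (a : 'I_n -> k) (g : 'I_n -> finite_dual {malg k[Nbar]}),
    (forall i, grouplike (g i)) /\
    f = \sum_(i < n) a i *: g i.
Proof.
have [N fN] := finite_dual_stationary k f.
(* The first N indices carry the finite thresholds, the last one the
   infinite threshold. *)
pose coef (i : 'I_N.+1) : k :=
  if unlift ord_max i is Some t then f (step k t) else f (chain k N).
pose cut (i : 'I_N.+1) := omap (@nat_of_ord N) (unlift ord_max i).
exists N.+1, coef, (fun i => threshold k (cut i)); split=> [i|].
  exact: threshold_grouplike.
rewrite [LHS](finite_dual_threshold k f N fN) big_ord_recr /=.
rewrite /coef /cut unlift_none /=; congr (_ + _); apply: eq_bigr => t _.
suff -> : widen_ord (leqnSn N) t = lift ord_max t by rewrite liftK.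
by apply: ord_inj; rewrite lift_max.
Qed.
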